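(* Let $\mathcal{v\!H}$ be the group given by the presentation $$\mathcal{v\!H} = \left\langle a,b,t \mid [a,[a,b]] = [b,[a,b]] = t^2 = 1,\ a^t = b \right\rangle,$$ and let $S = \{a,a^{-1},t\}$, which is a generating set for $\mathcal{v\!H}$. Then the geodesic growth function $\gamma_S$ of $\mathcal{v\!H}$ with respect to $S$ is bounded from above by a polynomial of degree $8$; that is, there is a polynomial $p$ of degree $8$ such that $\gamma_S(n) \leq p(n)$ for all $n \in \mathbb{N}$.
   Context: Conventions: $[x,y] = xyx^{-1}y^{-1}$ and $a^t = t^{-1}at$ (which equals $tat$, since $t^2=1$). The group $\mathcal{v\!H}$ is called the virtually Heisenberg group; it contains the discrete Heisenberg group $\mathcal{H} = \langle a,b \mid [a,[a,b]] = [b,[a,b]] = 1\rangle$ as the subgroup generated by $a$ and $b$, of index $2$. Let $G$ be a group with a finite (monoid) generating set $X$. For each word $w = w_1w_2\cdots w_k \in X^*$ (the free monoid on the set $X$), write $|w|_X = k$ for its word length and $\overline{w} \in G$ for the element of $G$ represented by $w$. For $g \in G$, let $\ell_X(g) = \min\{|w|_X : w \in X^*,\ \overline{w} = g\}$. A word $w \in X^*$ is a geodesic (with respect to $X$) if $\ell_X(\overline{w}) = |w|_X$. The geodesic growth function of $G$ with respect to $X$ is $$\gamma_X(n) = \#\{ w \in X^* : \ell_X(\overline{w}) = |w|_X \leq n \},$$ i.e. the number of geodesic words over $X$ of length at most $n$. *)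

(* Defs.v *)
From HB Require Import structures.
From mathcomp Require Import all_boot all_order all_algebra.
From mathcomp Require Import generic_quotient finmap.
From mathcomp Require Import boolp reals.

Set Implicit Arguments.
Unset Strict Implicit.
Unset Printing Implicit Defensive.

Local Open Scope quotient_scope.

Section PresentedGroup.
Variable I : choiceType.

(* The letter (x, true) stands for the generator x, and (x, false) for its
   formal inverse. *)
Definition gword := seq (I * bool).

Definition gw_inv (u : gword) : gword := rev [seq (x.1, ~~ x.2) | x <- u].

(* [u, v] = u v u^-1 v^-1 ; this differs from MathComp's [~ u, v]. *)
Definition gw_comm (u v : gword) : gword := u ++ v ++ gw_inv u ++ gw_inv v.

Definition gw_conj (u v : gword) : gword := gw_inv v ++ u ++ v.

Variable rels : seq (gword * gword).

Inductive pres_eqv : gword -> gword -> Prop :=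
| PresRel u v of (u, v) \in rels : pres_eqv u v
| PresCancel x s : pres_eqv [:: (x, s); (x, ~~ s)] [::]
| PresRefl u : pres_eqv u u
| PresSym u v of pres_eqv u v : pres_eqv v u
| PresTrans u v w of pres_eqv u v & pres_eqv v w : pres_eqv u w
| PresCat u u' v v' of pres_eqv u u' & pres_eqv v v' :
    pres_eqv (u ++ v) (u' ++ v').

Definition pres_rel : rel gword := fun u v => `[< pres_eqv u v >].

Lemma pres_rel_equiv : equiv_class_of pres_rel.
Proof.
split=> [u|u v|v u w]; first by apply/asboolP; exact: PresRefl.
- by apply/asboolP/asboolP; exact: PresSym.
- by move=> /asboolP uv /asboolP vw; apply/asboolP; exact: PresTrans uv vw.
Qed.

Canonical pres_rel_equiv_rel := EquivRelPack pres_rel_equiv.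

(* The group < I | u = v for (u, v) in rels >. *)
Definition presented := {eq_quot pres_rel}.

HB.instance Definition _ := Choice.on presented.
HB.instance Definition _ := EqQuotient.on presented.

Definition pres_cl (u : gword) : presented := \pi_presented u.

Lemma pres_clP u v : pres_cl u = pres_cl v <-> pres_eqv u v.
Proof.
by split=> [/eqP|uv]; [rewrite piE => /asboolP|apply/eqP; rewrite piE; apply/asboolP].
Qed.

Definition pres_one : presented := pres_cl [::].
Definition pres_mul (g h : presented) : presented := pres_cl (repr g ++ repr h).
Definition pres_inv (g : presented) : presented := pres_cl (gw_inv (repr g)).

Lemma repr_pres_cl u : pres_eqv (repr (pres_cl u)) u.
Proof. by apply/pres_clP; rewrite /pres_cl reprK. Qed.

Lemma pres_cl_repr g : pres_cl (repr g) = g.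
Proof. exact: reprK. Qed.

Lemma pres_mulE u v : pres_mul (pres_cl u) (pres_cl v) = pres_cl (u ++ v).
Proof. by apply/pres_clP; apply: PresCat; exact: repr_pres_cl. Qed.

Lemma gw_invK : involutive gw_inv.
Proof.
move=> u; rewrite /gw_inv map_rev revK -map_comp -[RHS]map_id.
by apply: eq_map => -[x s] /=; rewrite negbK.
Qed.

Lemma gw_mulVw u : pres_eqv (gw_inv u ++ u) [::].
Proof.
elim: u => [|[x s] u IHu]; first exact: PresRefl.
rewrite /gw_inv /= rev_cons -cats1 -catA /=.
apply: PresTrans IHu; apply: PresCat; first exact: PresRefl.
rewrite -[X in pres_eqv X _]/([:: (x, ~~ s); (x, s)] ++ u) -[X in pres_eqv _ X]cat0s.
apply: PresCat; last exact: PresRefl.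
by rewrite -{2}[s]negbK; exact: PresCancel.
Qed.

Lemma pres_mulA : associative pres_mul.
Proof.
move=> g h k; rewrite -[g]pres_cl_repr -[h]pres_cl_repr -[k]pres_cl_repr.
by rewrite !pres_mulE catA.
Qed.

Lemma pres_mul1 : left_id pres_one pres_mul.
Proof. by move=> g; rewrite -[g]pres_cl_repr pres_mulE. Qed.

Lemma pres_mulg1 : right_id pres_one pres_mul.
Proof. by move=> g; rewrite -[g]pres_cl_repr pres_mulE cats0. Qed.

Lemma pres_mulV : left_inverse pres_one pres_inv pres_mul.
Proof.
move=> g; rewrite -{2}[g]pres_cl_repr pres_mulE.
by apply/pres_clP; exact: gw_mulVw.
Qed.

Lemma pres_mulgV : right_inverse pres_one pres_inv pres_mul.
Proof.
move=> g; rewrite -{1}[g]pres_cl_repr pres_mulE.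
by apply/pres_clP; rewrite -{1}[repr g]gw_invK; exact: gw_mulVw.
Qed.

HB.instance Definition _ := isGroup.Build presented
  pres_mulA pres_mul1 pres_mulg1 pres_mulV pres_mulgV.

Definition pres_gen (x : I) : presented := pres_cl [:: (x, true)].

End PresentedGroup.

Local Open Scope group_scope.

Section GeodesicGrowth.
Variables (G : groupType) (X : {fset G}).

Definition word_val (w : seq X) : G := \prod_(x <- w) val x.

Definition monoid_generates : Prop := forall g, exists w, word_val w = g.

Definition has_word_of_size (g : G) : pred nat :=
  fun k => `[< exists w, word_val w = g /\ size w = k >].

(* The value 0 is a junk value, used only for g outside the submonoid
   generated by X. *)
Definition word_length (g : G) : nat :=
  if pselect (exists k, has_word_of_size g k) is left gX then ex_minn gX else 0.

Definition is_geodesic (w : seq X) : bool := word_length (word_val w) == size w.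

Definition geodesic_growth (n : nat) : nat :=
  \sum_(k < n.+1) #|[set w : k.-tuple X | is_geodesic w]|.

End GeodesicGrowth.

Variant vH_index := IxA | IxB | IxT.

HB.instance Definition _ := gen_eqMixin vH_index.
HB.instance Definition _ := gen_choiceMixin vH_index.

Definition vH_rels : seq (gword vH_index * gword vH_index) :=
  let a := [:: (IxA, true)] in
  let b := [:: (IxB, true)] in
  let t := [:: (IxT, true)] in
  [:: (gw_comm a (gw_comm a b), [::]);
      (gw_comm b (gw_comm a b), [::]);
      (t ++ t, [::]);
      (gw_conj a t, b)].

Definition vH : groupType := presented vH_rels.

Definition vHa : vH := pres_gen vH_rels IxA.
Definition vHt : vH := pres_gen vH_rels IxT.

Definition vH_S : {fset vH} := [fset vHa; vHa^-1; vHt]%fset.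

(* Main.v *)
(* A word over a, a^-1, t traces a lattice path in the plane: t switches between
   horizontal and vertical steps, and with d = [b, a] the word represents
   a^x b^y d^z t^e, where (x, y) is the endpoint of the path, z its signed area
   and e the parity of the number of t's. With H (resp. V) the larger of the
   numbers of right and left (resp. up and down) steps, one has
   |2z - xy| <= 2VH - |x||y|, and any such z is the area of a path with at most
   the same numbers of horizontal and vertical steps, made of three horizontal
   and three vertical segments, costing six t's. A word with eight t's is therefore
   never geodesic; a geodesic is made of at most eight powers of a separated by
   t's, and there are O(k^7) such words of length k. *)
Require Import Defs.
From mathcomp Require Import all_boot all_order all_algebra.
From mathcomp Require Import reals boolp finmap.
From mathcomp Require Import zify ring.

Set Implicit Arguments.
Unset Strict Implicit.
Unset Printing Implicit Defensive.

Import Order.TTheory GRing.Theory Num.Theory.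

(** [None] is the letter t, [Some true] is a and [Some false] is its inverse. *)
Notation letter := (option bool).

(** * Lattice paths and their areas *)

Section Paths.
Local Open Scope ring_scope.

Definition sgb (s : bool) : int := if s then 1 else - 1.

Definition state := (int * int * int * bool)%type.

Definition start : state := (0, 0, 0, false).

(* In a state (x, y, z, e), the bit e says that the next steps are vertical and z
   is the integral of y dx along the path. *)
Definition step (p : state) (l : letter) : state :=
  let: (x, y, z, e) := p in
  match l with
  | None => (x, y, z, ~~ e)
  | Some s => if e then (x, y + sgb s, z, e) else (x + sgb s, y, z + sgb s * y, e)
  end.

Definition run := foldl step.

Definition block (m : int) : seq letter := nseq `|m| (Some (0 <= m)).

Lemma size_block m : size (block m) = `|m|%N.
Proof. exact: size_nseq. Qed.

Lemma run_nseq n s x y z e : run (x, y, z, e) (nseq n (Some s)) =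
  if e then (x, y + sgb s * n%:Z, z, e)
  else (x + sgb s * n%:Z, y, z + sgb s * n%:Z * y, e).
Proof.
elim: n x y z => [|n IHn] x y z /=.
  by rewrite !mulr0 !mul0r !addr0; case: e.
by case: e IHn => IHn; rewrite IHn; congr (_, _, _, _); rewrite -natz -[in RHS]natz; ring.
Qed.

Lemma run_block m x y z e : run (x, y, z, e) (block m) =
  if e then (x, y + m, z, e) else (x + m, y, z + m * y, e).
Proof.
have -> : run (x, y, z, e) (block m) = if e then (x, y + sgb (0 <= m) * `|m|%N%:Z, z, e)
  else (x + sgb (0 <= m) * `|m|%N%:Z, y, z + sgb (0 <= m) * `|m|%N%:Z * y, e).
  exact: run_nseq.
have -> : sgb (0 <= m) * `|m|%N%:Z = m by rewrite /sgb; case: ifP; lia.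
by [].
Qed.

Lemma run_cat p u v : run p (u ++ v) = run (run p u) v.
Proof. exact: foldl_cat. Qed.

Lemma run_t x y z e : run (x, y, z, e) [:: None] = (x, y, z, ~~ e).
Proof. by []. Qed.

(* R, L, U, D count the unit steps to the right, left, up and down, and
   [m, M] contains all heights of the path; a detour down to m and up to M
   costs M - m steps up or M - m steps down. *)
Lemma run_invariant (u : seq letter) : exists (R L U D : nat) (m M z : int),
  [/\ run start u = (R%:Z - L%:Z, U%:Z - D%:Z, z, odd (count_mem None u)),
      (R + L + U + D + count_mem None u)%N = size u,
      m <= 0 <= M /\ m <= U%:Z - D%:Z <= M,
      M - m <= U%:Z \/ M - m <= D%:Z &
      R%:Z * m - L%:Z * M <= z <= R%:Z * M - L%:Z * m].
Proof.
elim/last_ind: u => [|u l].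
  by exists 0%N, 0%N, 0%N, 0%N, 0, 0, 0; split=> //; lia.
case=> R [L] [U] [D] [m] [M] [z] [run_u size_u mM wid z_bd].
rewrite -cats1 run_cat run_u count_cat size_cat /= !addn0 !addn1 -size_u.
case: l => [s|] /=; last first.
  exists R, L, U, D, m, M, z; split=> //; last by lia.
  by congr (_, _, _, _); lia.
rewrite addn0; case: ifP => odd_u; case: s; rewrite /sgb.
- exists R, L, U.+1, D, m, (Num.max M (U.+1%:Z - D%:Z)), z; split; try by lia.
  + by congr (_, _, _, _); lia.
  + have : M <= Num.max M (U.+1%:Z - D%:Z) by lia.
    by move: (Num.max _ _) => M'; nia.
- exists R, L, U, D.+1, (Num.min m (U%:Z - D.+1%:Z)), M, z; split; try by lia.
  + by congr (_, _, _, _); lia.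
  + have : Num.min m (U%:Z - D.+1%:Z) <= m by lia.
    by move: (Num.min _ _) => M'; nia.
- exists R.+1, L, U, D, m, M, (z + 1 * (U%:Z - D%:Z)); split; try by lia.
  by congr (_, _, _, _); lia.
- exists R, L.+1, U, D, m, M, (z + (-1) * (U%:Z - D%:Z)); split; try by lia.
  by congr (_, _, _, _); lia.
Qed.

(** Let L <= R, so that x = R - L >= 0 and H = R. The upper bound on z in [run_invariant] is R (M -
    m) + x m, where M - m <= V, m <= min(0, y) and 2 min(0, y) - y = - |y|. The lower bound is
    treated alike with M >= max(0, y), and the case R < L is a reflection. The numbers 2 H - |x| and
    2 V - |y| count all horizontal and all vertical steps. *)
Lemma run_area_bound (u : seq letter) : exists x y z (H V : int),
  [/\ run start u = (x, y, z, odd (count_mem None u)),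
      2 * H - `|x| + (2 * V - `|y|) + (count_mem None u)%:Z = (size u)%:Z,
      `|x| <= H, `|y| <= V &
      `|2 * z - x * y| <= 2 * (V * H) - `|x| * `|y|].
Proof.
have [R [L] [U] [D] [m] [M] [z] [run_u size_u mM wid z_bd]] := run_invariant u.
exists (R%:Z - L%:Z), (U%:Z - D%:Z), z, (Num.max R%:Z L%:Z), (Num.max U%:Z D%:Z).
split; try by lia.
  by [].
have : M - m <= Num.max U%:Z D%:Z by lia.
move: (Num.max U%:Z D%:Z) => V MmV.
case: (leqP L R) => RL.
- have -> : Num.max R%:Z L%:Z = R%:Z by lia.
  have -> : `|R%:Z - L%:Z| = R%:Z - L%:Z by lia.
  have H1 : (R%:Z - L%:Z) * m <= 0 by nia.
  have H2 : (R%:Z - L%:Z) * M >= 0 by nia.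
  have H3 : (R%:Z - L%:Z) * m <= (R%:Z - L%:Z) * (U%:Z - D%:Z) by nia.
  have H4 : (R%:Z - L%:Z) * M >= (R%:Z - L%:Z) * (U%:Z - D%:Z) by nia.
  have H5 : R%:Z * (M - m) <= V * R%:Z by nia.
  case: (leqP D U) => DU.
  + have -> : `|U%:Z - D%:Z| = U%:Z - D%:Z by lia.
    by lia.
  + have -> : `|U%:Z - D%:Z| = - (U%:Z - D%:Z) by lia.
    by lia.
- have -> : Num.max R%:Z L%:Z = L%:Z by lia.
  have -> : `|R%:Z - L%:Z| = - (R%:Z - L%:Z) by lia.
  have H1 : (R%:Z - L%:Z) * m >= 0 by nia.
  have H2 : (R%:Z - L%:Z) * M <= 0 by nia.
  have H3 : (R%:Z - L%:Z) * m >= (R%:Z - L%:Z) * (U%:Z - D%:Z) by nia.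
  have H4 : (R%:Z - L%:Z) * M <= (R%:Z - L%:Z) * (U%:Z - D%:Z) by nia.
  have H5 : L%:Z * (M - m) <= V * L%:Z by nia.
  case: (leqP D U) => DU.
  + have -> : `|U%:Z - D%:Z| = U%:Z - D%:Z by lia.
    by lia.
  + have -> : `|U%:Z - D%:Z| = - (U%:Z - D%:Z) by lia.
    by lia.
Qed.

(* The path first makes the backward steps, then climbs a staircase whose only
   intermediate rise, of height 1, adjusts the area to the remainder of z modulo H. *)
Lemma staircase_nonneg (x y z H V : int) :
  0 <= x <= H -> 0 <= y <= V -> 0 <= z <= V * H ->
  exists h1 h2 h3 v1 v2 v3 : int,
  [/\ h1 + h2 + h3 = x, v1 + v2 + v3 = y,
      `|h1| + `|h2| + `|h3| <= 2 * H - x, `|v1| + `|v2| + `|v3| <= 2 * V - y &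
      z = h2 * v1 + h3 * (v1 + v2)].
Proof.
move=> xH yV zVH.
have [H0|Hpos] : H = 0 \/ 0 < H by lia.
  by exists 0, 0, 0, y, 0, 0; split; nia.
have z_div : z = (z %/ H)%Z * H + (z %% H)%Z by exact: divz_eq.
have r_bd : 0 <= (z %% H)%Z < H by lia.
move: (z %/ H)%Z (z %% H)%Z z_div r_bd => u r z_div r_bd.
have u0 : 0 <= u by nia.
have [uV|uV] : u + 1 <= V \/ V <= u by lia.
  by exists (x - H), (H - r), r, u, 1, (y - u - 1); split; try lia; rewrite z_div; ring.
(* Here z = V H is the area of the full rectangle, and no remainder is left to adjust. *)
have uE : u = V by nia.
have r0 : r = 0 by nia.
by exists (x - H), H, 0, V, 0, (y - V); split; try lia; rewrite z_div uE r0; ring.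
Qed.

(** Reflections in the axes reduce to x, y >= 0, where the bound says that z and x y - z are both at
    most V H. The two formulas for z are the areas of paths starting with a horizontal and with a
    vertical segment. *)
Lemma staircase (x y z H V : int) :
  `|x| <= H -> `|y| <= V -> `|2 * z - x * y| <= 2 * (V * H) - `|x| * `|y| ->
  exists h1 h2 h3 v1 v2 v3 : int,
  [/\ h1 + h2 + h3 = x, v1 + v2 + v3 = y,
      `|h1| + `|h2| + `|h3| <= 2 * H - `|x|, `|v1| + `|v2| + `|v3| <= 2 * V - `|y| &
      z = h2 * v1 + h3 * (v1 + v2) \/ z = h1 * v1 + h2 * (v1 + v2) + h3 * y].
Proof.
move=> xH yV z_bd.
wlog x0 : x z xH z_bd / 0 <= x.
  move=> main; case: (leP 0 x) => x0; first exact: main.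
  have [|||h1 [h2] [h3] [v1] [v2] [v3] [Ex Ey bx by_ Ez]] := main (- x) (- z);
    try by rewrite ?(mulrN, mulNr) -?opprD ?normrN; lia.
  exists (- h1), (- h2), (- h3), v1, v2, v3; split; lia.
wlog y0 : y z yV z_bd / 0 <= y.
  move=> main; case: (leP 0 y) => y0; first exact: main.
  have [|||h1 [h2] [h3] [v1] [v2] [v3] [Ex Ey bx by_ Ez]] := main (- y) (- z);
    try by rewrite ?(mulrN, mulNr) -?opprD ?normrN; lia.
  exists h1, h2, h3, (- v1), (- v2), (- v3); split; lia.
have xE : `|x| = x by lia.
have yE : `|y| = y by lia.
rewrite xE yE in xH yV z_bd *.
have [z0|z0] : 0 <= z \/ z < 0 by lia.
  have [|||h1 [h2] [h3] [v1] [v2] [v3] [Ex Ey bx by_ Ez]] :=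
    @staircase_nonneg x y z H V; try by lia.
  by exists h1, h2, h3, v1, v2, v3; split=> //; left.
(* reversing the order of the steps turns the area z into x y - z *)
have [|||h1 [h2] [h3] [v1] [v2] [v3] [Ex Ey bx by_ Ez]] :=
    @staircase_nonneg x y (x * y - z) H V; try by nia.
by exists h3, h2, h1, v3, v2, v1; split; lia.
Qed.

Definition turns (hs : seq int) : seq letter :=
  flatten [seq block m ++ [:: None] | m <- hs].

(** The staircase has no more horizontal or vertical steps than u, and six t's. Evenness makes both
    words end in the same direction. *)
Lemma few_turns_word (u : seq letter) : ~~ odd (count_mem None u) ->
  exists v, run start v = run start u /\
    (size v + count_mem None u <= size u + 6)%N.
Proof.
move=> even_u.
have [x [y] [z] [H] [V] [run_u size_u xH yV z_bd]] := run_area_bound u.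
have [h1 [h2] [h3] [v1] [v2] [v3] [Ex Ey bx by_ [Ez|Ez]]] := staircase xH yV z_bd.
- exists (turns [:: h1; v1; h2; v2; h3; v3]); split; last first.
    rewrite /turns /= !size_cat /= !size_block.
    by move: (count_mem _ u) (size u) size_u => c s; lia.
  rewrite run_u (negbTE even_u) /turns /= cats0 !run_cat /start.
  do !rewrite !(run_block, run_t) /=.
  by congr (_, _, _, _); rewrite ?Ez -?Ex -?Ey; ring.
(* A vertical start costs a leading t, but the last segment is horizontal and needs no closing t:
   again six in all. *)
- exists (None :: turns [:: v1; h1; v2; h2; v3] ++ block h3); split; last first.
    rewrite /turns /= !size_cat /= !size_block.
    by move: (count_mem _ u) (size u) size_u => c s; lia.
  rewrite run_u (negbTE even_u) /turns /= cats0 -cat1s !run_cat /start.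
  do !rewrite !(run_block, run_t) /=.
  by congr (_, _, _, _); rewrite ?Ez -?Ex -?Ey; ring.
Qed.

End Paths.

(** * Integer powers in a group *)

Section IntegerPowers.
Local Open Scope group_scope.
Variable G : groupType.
Implicit Types (g h : G) (m n : int).

Definition zpow g n : G := match n with Posz k => g ^+ k | Negz k => g ^- k.+1 end.

Lemma zpow_succ g n : zpow g (n + 1)%R = zpow g n * g.
Proof.
case: n => [n|[|n]].
- have -> : (Posz n + 1)%R = n.+1 by lia.
  exact: expgSr.
- by rewrite /= mulVg.
- have -> : (Negz n.+1 + 1)%R = Negz n by lia.
  by rewrite /zpow [g ^+ n.+2]expgS invgM mulgVK.
Qed.

Lemma zpow_pred g n : zpow g (n - 1)%R = zpow g n * g^-1.
Proof. by rewrite -[in RHS](subrK 1%R n) zpow_succ mulgK. Qed.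

Lemma zpowD g m n : zpow g (m + n)%R = zpow g m * zpow g n.
Proof.
elim: n => [|n IHn|n IHn]; first by rewrite addr0 mulg1.
- by rewrite -addn1 PoszD addrA !zpow_succ IHn mulgA.
- by rewrite -addn1 PoszD opprD addrA !zpow_pred IHn mulgA.
Qed.

Lemma commute_zpow g h n : commute g h -> commute g (zpow h n).
Proof.
move=> gh; case: n => n /=; first exact: commuteX.
by apply: commuteV; exact: commuteX.
Qed.

Lemma zpow_conj g h n : zpow g n ^ h = zpow (g ^ h) n.
Proof. by case: n => n /=; rewrite ?conjVg conjXg. Qed.

Lemma zpowM g h n : commute g h -> zpow (g * h) n = zpow g n * zpow h n.
Proof.
move=> gh; case: n => n /=; first exact: expgMn.
rewrite expgMn // invgM; apply: commute_sym; apply/commuteV/commute_sym/commuteV.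
exact/commute_sym/commuteX2.
Qed.

Lemma zpowV g n : zpow g^-1 n = zpow g (- n)%R.
Proof.
elim: n => [|n IHn|n IHn] //; rewrite -addn1 PoszD ?opprD.
- by rewrite zpow_succ zpow_pred IHn.
- by rewrite !opprK zpow_pred zpow_succ IHn opprK invgK.
Qed.

End IntegerPowers.

(** * The normal form a^x b^y d^z t^e *)

Section NormalForm.
Local Open Scope group_scope.
Variables (G : groupType) (a b d t : G).
Hypotheses (tt : t * t = 1) (ta : t * a = b * t).
Hypotheses (ad : commute a d) (bd : commute b d) (ba : b * a = a * b * d).

Definition letter_val (l : letter) : G :=
  match l with None => t | Some s => if s then a else a^-1 end.

Definition nf (p : state) : G :=
  let: (x, y, z, e) := p in zpow a x * zpow b y * zpow d z * (if e then t else 1).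

Lemma zpow_sgb g s : zpow g (sgb s) = if s then g else g^-1 :> G.
Proof. by case: s. Qed.

(** Conjugation by a turns b into b d, hence b^y into b^y d^y, since b and d commute. The factor d^y
    is the area gained by a horizontal step at height y. *)
Lemma zpow_comm_sgb (y : int) s :
  zpow b y * zpow a (sgb s) = zpow a (sgb s) * zpow b y * zpow d (sgb s * y)%R.
Proof.
have b_a : b ^ a = b * d by rewrite conjgE ba -mulgA mulKg.
rewrite conjgC zpow_conj -mulgA; congr (_ * _).
rewrite zpow_sgb; case: s; first by rewrite mul1r b_a zpowM.
have -> : b ^ a^-1 = b * d^-1.
  apply: (conjg_inj a); rewrite conjgKV conjMg b_a conjVg.
  by rewrite [d ^ a]conjgE -ad mulKg mulgK.
rewrite zpowM; last exact: commuteV.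
by rewrite zpowV mulN1r.
Qed.

Lemma nf_step p l : nf p * letter_val l = nf (step p l).
Proof.
case: p => -[[x y] z] e; case: l => [s|] /=; last first.
  by case: e; rewrite /= -mulgA ?tt ?mul1g ?mulg1.
have dC g : commute g d -> commute g (zpow d z) by exact: commute_zpow.
(* Moving a step to the left of t makes it vertical. *)
have tas : t * zpow a (sgb s) = zpow b (sgb s) * t.
  rewrite !zpow_sgb; case: s => //; apply: (mulIg a); apply: (mulgI b).
  by rewrite mulgVK -ta -!mulgA mulVKg.
rewrite -zpow_sgb; case: e => /=.
  rewrite -mulgA tas mulgA -[_ * _ * zpow b (sgb s)]mulgA.
  rewrite -(@commute_zpow _ (zpow b (sgb s))) ?zpowD ?mulgA //.
  by apply/commute_sym/commute_zpow/commute_sym.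
rewrite !mulg1 -mulgA -(@commute_zpow _ (zpow a (sgb s))); last first.
  by apply/commute_sym/commute_zpow/commute_sym.
rewrite mulgA -[_ * _ * zpow a (sgb s)]mulgA zpow_comm_sgb.
by rewrite [(z + _)%R]addrC !zpowD !mulgA.
Qed.

Lemma nf_run p u : nf p * \prod_(l <- u) letter_val l = nf (run p u).
Proof.
elim: u p => [|l u IHu] p; first by rewrite big_nil mulg1.
by rewrite big_cons mulgA nf_step IHu.
Qed.

End NormalForm.

(** * The virtually Heisenberg group *)

Section VirtuallyHeisenberg.
Local Open Scope group_scope.

Let vHb : vH := pres_gen vH_rels IxB.

Lemma pres_cl_cat u v :
  pres_cl vH_rels (u ++ v) = (pres_cl vH_rels u : vH) * pres_cl vH_rels v.
Proof. by rewrite -pres_mulE. Qed.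

Lemma pres_cl_inv u : pres_cl vH_rels (gw_inv u) = (pres_cl vH_rels u : vH)^-1.
Proof.
apply/esym/mulg1_eq; rewrite -pres_cl_cat.
by apply/pres_clP; rewrite -{1}[u]gw_invK; exact: gw_mulVw.
Qed.

Lemma pres_cl_comm u v : pres_cl vH_rels (gw_comm u v) =
  (pres_cl vH_rels u : vH) *
    ((pres_cl vH_rels v : vH) * ((pres_cl vH_rels u : vH)^-1 * (pres_cl vH_rels v : vH)^-1)).
Proof. by rewrite /gw_comm !pres_cl_cat !pres_cl_inv. Qed.

Lemma vH_rel i : (i < 4)%N ->
  let uv := nth ([::], [::]) vH_rels i in pres_cl vH_rels uv.1 = pres_cl vH_rels uv.2.
Proof.
move=> i4; apply/pres_clP/PresRel; rewrite -surjective_pairing.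
exact: mem_nth.
Qed.

Lemma vHtt : vHt * vHt = 1.
Proof. by rewrite -pres_cl_cat (vH_rel (isT : 2 < 4)%N). Qed.

Lemma vHta : vHt * vHa = vHb * vHt.
Proof.
have : vHt^-1 * (vHa * vHt) = vHb.
  have /= := vH_rel (isT : 3 < 4)%N.
  by rewrite /gw_conj !pres_cl_cat pres_cl_inv.
by move=> <-; rewrite (mulg1_eq vHtt) -!mulgA vHtt mulg1.
Qed.

Let c : vH := vHa * (vHb * (vHa^-1 * vHb^-1)).

Lemma vHac : commute vHa c.
Proof.
have comm1 : vHa * (c * (vHa^-1 * c^-1)) = 1.
  by have /= := vH_rel (isT : 0 < 4)%N; rewrite !pres_cl_comm.
by apply: (mulIg (vHa^-1 * c^-1)); rewrite -mulgA comm1 -mulgA mulVKg mulgV.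
Qed.

Lemma vHbc : commute vHb c.
Proof.
have comm1 : vHb * (c * (vHb^-1 * c^-1)) = 1.
  by have /= := vH_rel (isT : 1 < 4)%N; rewrite !pres_cl_comm.
by apply: (mulIg (vHb^-1 * c^-1)); rewrite -mulgA comm1 -mulgA mulVKg mulgV.
Qed.

(** This makes [c^-1] the d of the normal form. *)
Lemma vHba : vHb * vHa = vHa * vHb * c^-1.
Proof.
have ab : vHa * vHb = c * (vHb * vHa) by rewrite /c -!mulgA mulKg mulVg mulg1.
have -> : vHa * vHb * c^-1 = c^-1 * (vHa * vHb).
  by apply/commute_sym/commuteM; apply/commute_sym/commuteV; [exact: vHac|exact: vHbc].
by rewrite ab mulKg.
Qed.

Definition emb_subproof (l : letter) : letter_val vHa vHt l \in vH_S.
Proof. by case: l => [[]|]; rewrite !inE eqxx ?orbT. Qed.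

Definition emb (l : letter) : vH_S := FSetSub (emb_subproof l).

Lemma embP (x : vH_S) : exists l, emb l = x.
Proof.
case: x => x x_in; have: x \in vH_S by [].
rewrite !inE -orbA => /or3P[]/eqP x_eq;
  [exists (Some true)|exists (Some false)|exists None]; exact/val_inj.
Qed.

Lemma emb_wordP (w : seq vH_S) : exists u, map emb u = w.
Proof.
elim: w => [|x w [u <-]]; first by exists [::].
by have [l <-] := embP x; exists (l :: u).
Qed.

(** Each word represents the normal form of its final state. *)
Lemma word_val_run u v : run start u = run start v ->
  word_val (map emb u) = word_val (map emb v).
Proof.
have word_val_nf w : word_val (map emb w) = nf vHa vHb c^-1 vHt (run start w).
  have cV g : commute g c -> commute g c^-1 by exact: commuteV.
  rewrite -(nf_run vHtt vHta (cV _ vHac) (cV _ vHbc) vHba) /= !mulg1 mul1g.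
  by rewrite /word_val big_map.
by rewrite !word_val_nf => ->.
Qed.

Lemma word_val_cat (w1 w2 : seq vH_S) : word_val (w1 ++ w2) = word_val w1 * word_val w2.
Proof. exact: big_cat. Qed.

Lemma vH_generates : monoid_generates vH_S.
Proof.
have gen1 (l : letter) : word_val [:: emb l] = letter_val vHa vHt l by exact: big_seq1.
have gen x s : exists w : seq vH_S, word_val w = pres_cl vH_rels [:: (x, s)].
  have -> : pres_cl vH_rels [:: (x, s)] =
      if s then pres_gen vH_rels x : vH else (pres_gen vH_rels x : vH)^-1.
    by case: s => //; rewrite -pres_cl_inv.
  have tV : vHt^-1 = vHt by exact: (mulg1_eq vHtt).
  (* Of the three generators only b is missing from [vH_S]; conjugating a by t recovers it. *)
  have bE : vHb = vHt * vHa * vHt by rewrite vHta -mulgA vHtt mulg1.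
  case: x.
  - by exists [:: emb (Some s)]; rewrite gen1.
  - exists [:: emb None; emb (Some s); emb None].
    rewrite -cat1s -[[:: _; emb None]]cat1s !word_val_cat !gen1 /=.
    by rewrite -/vHb bE; case: s; rewrite ?invgM ?tV ?mulgA.
  - by exists [:: emb None]; rewrite gen1 /= -/vHt tV if_same.
move=> g; rewrite -[g]pres_cl_repr.
elim: (repr g) => [|[x s] u [w w_val]]; first by exists [::]; exact: big_nil.
have [v v_val] := gen x s; exists (v ++ w).
by rewrite word_val_cat v_val w_val -pres_cl_cat.
Qed.

End VirtuallyHeisenberg.

(** * Counting geodesics *)

Section Counting.
Local Open Scope nat_scope.

Lemma geodesic_min (G : groupType) (X : {fset G}) (w w' : seq X) :
  is_geodesic w -> word_val w' = word_val w -> size w <= size w'.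
Proof.
rewrite /is_geodesic /word_length; case: pselect => [ex|nex]; last first.
  (* The word [w] itself rules out the junk value of [word_length]. *)
  by case: nex; exists (size w); apply/asboolP; exists w.
case: ex_minnP => m _ min_m /eqP <- w'w.
by apply: min_m; apply/asboolP; exists w'.
Qed.

(** Equal final states from [start] mean equal group elements, so v can replace u2 inside the word,
    whatever state u1 leads to. *)
Lemma geodesic_factor u1 u2 u3 v : is_geodesic (map emb (u1 ++ u2 ++ u3)) ->
  run start v = run start u2 -> size u2 <= size v.
Proof.
move=> geo vu2.
have := geodesic_min (w' := map emb (u1 ++ v ++ u3)) geo.
rewrite !map_cat !word_val_cat (word_val_run vu2) => /(_ erefl).
by rewrite !size_cat !size_map leq_add2l leq_add2r.
Qed.

Lemma count_take_exact (T : Type) (a : pred T) (s : seq T) n :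
  n <= count a s -> exists i, count a (take i s) = n.
Proof.
elim: s n => [|x s IHs] [|n] //=; try by exists 0.
case ax: (a x) => /=; rewrite ?add0n ?add1n => n_le.
  by have [i i_n] := IHs n n_le; exists i.+1; rewrite /= ax i_n.
by have [i i_n] := IHs n.+1 n_le; exists i.+1; rewrite /= ax i_n.
Qed.

(** A prefix with exactly eight t's has evenly many, so [few_turns_word] replaces it by a word at
    least two letters shorter. *)
Lemma geodesic_turns u : is_geodesic (map emb u) -> count_mem None u <= 7.
Proof.
move=> geo; rewrite leqNgt; apply/negP => /count_take_exact[i i8].
have [|v [v_run v_size]] := @few_turns_word (take i u); first by rewrite i8.
rewrite i8 in v_size.
have := @geodesic_factor [::] (take i u) (drop i u) v; rewrite /= cat_take_drop.
by move=> /(_ geo v_run); lia.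
Qed.

Definition reduced (u : seq letter) :=
  forall u1 s u2, u <> u1 ++ [:: Some s; Some (~~ s)] ++ u2.

Lemma geodesic_reduced u : is_geodesic (map emb u) -> reduced u.
Proof.
move=> geo u1 s u2 uE; rewrite uE in geo.
suff: size [:: Some s; Some (~~ s)] <= @size letter [::] by [].
by apply: geodesic_factor geo _; case: s {uE}.
Qed.

Lemma reduced_catr u v : reduced (u ++ v) -> reduced v.
Proof. by move=> red u1 s u2 vE; apply: (red (u ++ u1) s u2); rewrite vE catA. Qed.

Lemma leading_block u : reduced u -> exists m s,
  u = nseq m (Some s) \/ exists u', u = nseq m (Some s) ++ None :: u'.
Proof.
elim: u => [|[s|] u IHu] red; first by exists 0, true; left.
  have [|[|m] [s' u_E]] := IHu; first exact: (@reduced_catr [:: Some s]).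
    exists 1, s; case: u_E => [->|[u' ->]]; [by left|by right; exists u'].
  (* The next block is nonempty, so an opposite sign would give a cancelling pair. *)
  have ss' : s' = s.
    case: u_E => [uE|[u' uE]]; apply/eqP; rewrite eq_sym -[_ == _]negbK;
    apply/negP => ss'; have s'E : s' = ~~ s by case: (s) (s') ss' => -[].
      by apply: (red [::] s (nseq m (Some s'))); rewrite uE s'E.
    by apply: (red [::] s (nseq m (Some s') ++ None :: u')); rewrite uE s'E.
  exists m.+2, s; rewrite -ss'; case: u_E => [->|[u' ->]]; [by left|by right; exists u'].
by exists 0, true; right; exists u.
Qed.

(** The last block has the fixed length K: words of length at most K are recovered as prefixes, so
    the length of their last block need not be encoded. This saves a factor of order K in the
    count. *)
Definition expand K (bs : seq (nat * bool)) (s : bool) : seq letter :=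
  flatten [seq nseq b.1 (Some b.2) ++ [:: None] | b <- bs] ++ nseq K (Some s).

Lemma reduced_expand K j u : reduced u -> count_mem None u <= j -> size u <= K ->
  exists bs s, [/\ size bs = j, all (fun b => b.1 <= K) bs & prefix u (expand K bs s)].
Proof.
elim: j u => [|j IHj] u red_u; have [m [s [uE|[u' uE]]]] := leading_block red_u.
- move=> _; rewrite uE size_nseq => mK; exists [::], s; split=> //.
  by rewrite /expand /= -(subnKC mK) nseqD prefix_prefix.
- by rewrite uE count_cat /= addnS.
(* The word is a single block; the other entries are mere padding after the prefix. *)
- move=> _; rewrite uE size_nseq => mK; exists (nseq j.+1 (m, s)), s; split.
  + by rewrite size_nseq.
  + by rewrite all_nseq mK orbT.
  + by rewrite /expand /= -!catA prefix_prefix.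
- rewrite uE count_cat size_cat size_nseq /= => cnt sz.
  have [|||bs [s' [bs_size bs_K bs_pre]]] := IHj u'.
  + by apply: (@reduced_catr (nseq m (Some s) ++ [:: None])); rewrite -catA -uE.
  + by rewrite -ltnS -add1n; apply: leq_trans cnt; exact: leq_addl.
  + by lia.
  exists ((m, s) :: bs), s'; split; rewrite /= ?bs_size //.
    by rewrite bs_K andbT; lia.
  have /prefixP[r rE] := bs_pre.
  apply/prefixP; exists r; rewrite -!catA /= -rE /expand /=.
  by rewrite -!catA.
Qed.

(** The expansion ends with k equal letters, so the default of [nth] is never reached. *)
Definition decode k (c : 7.-tuple ('I_k.+1 * bool) * bool) : k.-tuple vH_S :=
  [tuple nth (emb None)
     (map emb (expand k [seq (nat_of_ord b.1, b.2) | b <- c.1] c.2)) i | i < k].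

Lemma geodesic_decode k (w : k.-tuple vH_S) : is_geodesic w -> exists c, w = decode c.
Proof.
move=> geo; have [u uE] := emb_wordP w; rewrite -uE in geo.
have u_k : size u = k by rewrite -(size_map emb) uE size_tuple.
have [|bs [s [bs7 bs_k /prefixP[r rE]]]] :=
  reduced_expand (K := k) (geodesic_reduced geo) (geodesic_turns geo).
  by rewrite u_k.
have bs_size : size [seq (inord b.1 : 'I_k.+1, b.2) | b <- bs] == 7.
  by rewrite size_map bs7.
exists (Tuple bs_size, s); apply: eq_from_tnth => i; rewrite tnth_mktuple /=.
have -> : [seq (nat_of_ord b.1, b.2) | b <- [seq (inord b.1 : 'I_k.+1, b.2) | b <- bs]] = bs.
  rewrite -map_comp -[RHS]map_id; apply/eq_in_map => -[m s'] /(allP bs_k) /= mk.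
  by rewrite inordK.
by rewrite rE map_cat nth_cat size_map u_k ltn_ord uE (tnth_nth (emb None)).
Qed.

Lemma card_geodesics k :
  #|[set w : k.-tuple vH_S | is_geodesic w]| <= (k.+1 * 2) ^ 7 * 2.
Proof.
have -> : (k.+1 * 2) ^ 7 * 2 = #|{: 7.-tuple ('I_k.+1 * bool) * bool}|.
  by rewrite card_prod card_tuple card_prod card_ord card_bool.
rewrite -cardsT; apply: leq_trans (leq_imset_card (@decode k) _).
apply/subset_leq_card/subsetP => w; rewrite inE => /geodesic_decode[c ->].
exact: imset_f.
Qed.

Lemma geodesic_growth_le n : geodesic_growth vH_S n <= 256 * n.+1 ^ 8.
Proof.
(* The codes contribute degree 7 and the summation over k one more; the constant is 2^7 times 2. *)
apply: (@leq_trans (\sum_(k < n.+1) (n.+1 * 2) ^ 7 * 2)).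
  apply: leq_sum => k _; apply: leq_trans (card_geodesics k) _.
  by rewrite leq_mul2r leq_exp2r // leq_mul2r ltn_ord.
by rewrite sum_nat_const card_ord expnMn; lia.
Qed.

End Counting.

Theorem theorem1 (R : realType) :
  monoid_generates vH_S /\
  exists p : {poly R}, size p = 9 /\
    forall n : nat, ((geodesic_growth vH_S n)%:R <= p.[n%:R])%R.
Proof.
split; first exact: vH_generates.
(* This is 256 (X + 1)^8, of degree 8 and hence of [size] 9. *)
exists (256%:R *: ('X - (-1)%:P) ^+ 8)%R; split=> [|n].
  by rewrite size_scale ?size_exp_XsubC // pnatr_eq0.
rewrite hornerZ horner_exp hornerXsubC opprK natr1 -natrX -natrM ler_nat.
exact: geodesic_growth_le.
Qed.
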